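(* Let $M$ be a type III von Neumann factor and let $N_1\subset M$, $N_2\subset M$ be type III subfactors of finite index with inclusion homomorphisms $\iota_1,\iota_2$. Let $\Delta_i$ be a finite closed $N_i$-system and $(\iota_i,\alpha^i)$ an extension of $\Delta_i$ ($i=1,2$). Assume in addition that $\Delta_1$ and $\Delta_2$ are braided, with unitary braidings $\varepsilon_1$ and $\varepsilon_2$ respectively, turning $\Pi(\Delta_1)$ and $\Pi(\Delta_2)$ into braided monoidal categories. Suppose that for all $\lambda_i,\mu_i\in\Delta_i$ ($i=1,2$) and all $\phi\in \mathrm{Hom}(\alpha^1_{\lambda_1},\alpha^2_{\lambda_2})$, $\psi\in \mathrm{Hom}(\alpha^1_{\mu_1},\alpha^2_{\mu_2})$, $$(\psi\times\phi)\circ\iota_1(\varepsilon_1(\lambda_1,\mu_1))=\iota_2(\varepsilon_2(\lambda_2,\mu_2))\circ(\phi\times\psi).$$ Let $A=N_1\otimes N_2^{\mathrm{opp}}$, and let $\theta\in\mathrm{End}_{\mathrm{fin}}(A)$, the canonical isometry $w_1\in \mathrm{Hom}(\theta,\theta^2)$ and the induced braiding operator $\varepsilon(\theta,\theta)$ be as constructed in the context. Then $$\varepsilon(\theta,\theta)\,w_1=w_1 .$$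
   Context: All von Neumann factors are of type III. For a factor $N$, $\mathrm{End}_{\mathrm{fin}}(N)$ is the set of unital endomorphisms $\lambda$ of $N$ with finite (minimal, Longo–Roberts) dimension $d(\lambda)$. $\mathrm{Hom}(\rho,\sigma)$ is the space of $T$ with $T\rho(x)=\sigma(x)T$ for all $x$. The monoidal product of $S\in\mathrm{Hom}(\rho,\sigma)$ and $T\in\mathrm{Hom}(\rho',\sigma')$ is $S\times T=S\rho(T)=\sigma(T)S\in\mathrm{Hom}(\rho\rho',\sigma\sigma')$; $\circ$ between intertwiners is operator multiplication. Closed $N$-system: a set $\Delta\subset \mathrm{End}_{\mathrm{fin}}(N)$ of mutually inequivalent irreducible endomorphisms such that (i) $\mathrm{id}_N\in\Delta$; (ii) if $\lambda\in\Delta$ then there is a conjugate endomorphism $\bar\lambda\in\Delta$; (iii) if $\lambda,\mu\in\Delta$ then $\lambda\mu$ is equivalent to a finite direct sum of elements of $\Delta$. $\Pi(\Delta)$ is the set of finite products of elements of $\Delta$, viewed as the objects of a full monoidal C* subcategory of $\mathrm{End}_{\mathrm{fin}}(N)$. A unitary braiding on it is a family of unitaries $\varepsilon(\rho,\sigma)\in\mathrm{Hom}(\rho\sigma,\sigma\rho)$, natural in $\rho,\sigma$ and satisfying the usual braiding (hexagon) identities. Extension: for a finite index subfactor $N\subset M$ with inclusion homomorphism $\iota$, an extension of a closed $N$-system $\Delta$ is a pair $(\iota,\alpha)$ with $\alpha:\Delta\to \mathrm{End}_{\mathrm{fin}}(M)$, $\lambda\mapsto\alpha_\lambda$, such that for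 all $\lambda,\mu,\nu\in\Delta$: (E1) $\iota\circ\lambda=\alpha_\lambda\circ\iota$; (E2) $\iota(\mathrm{Hom}(\nu,\lambda\mu))\subset \mathrm{Hom}(\alpha_\nu,\alpha_\lambda\alpha_\mu)$. $N^{\mathrm{opp}}$ is the opposite algebra (reversed product), $x\mapsto x^{\mathrm{opp}}$ the identification, $\lambda^{\mathrm{opp}}(x^{\mathrm{opp}})=\lambda(x)^{\mathrm{opp}}$. If $T\in\mathrm{Hom}(\alpha,\beta)$ in $N$, then $(T^* )^{\mathrm{opp}}\in\mathrm{Hom}(\alpha^{\mathrm{opp}},\beta^{\mathrm{opp}})$ in $N^{\mathrm{opp}}$. Left-inverses: for $\lambda\in\Delta_i$ with conjugate $\bar\lambda\in\Delta_i$ choose isometries $R_\lambda\in\mathrm{Hom}(\mathrm{id},\bar\lambda\lambda)$, $\bar R_\lambda\in\mathrm{Hom}(\mathrm{id},\lambda\bar\lambda)$ with $(1_\lambda\times R_\lambda^* )(\bar R_\lambda\times 1_\lambda)=d(\lambda)^{-1}1_\lambda$ and $(1_{\bar\lambda}\times\bar R_\lambda^* )(R_\lambda\times1_{\bar\lambda})=d(\lambda)^{-1}1_{\bar\lambda}$. The induced left-inverse of $\alpha^i_\lambda$ is $\Phi^i_\lambda(X)=\iota_i(R_\lambda)^*\,\alpha^i_{\bar\lambda}(X)\,\iota_i(R_\lambda)$; on $\mathrm{Hom}(\alpha^i_\lambda,\alpha^i_\lambda)$ it is scalar valued. Construction of $\theta$ and $w_1$. Put $Z_{\lambda_1,\lambda_2}=\dim\mathrm{Hom}(\alpha^1_{\lambda_1},\alpha^2_{\lambda_2})$.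 Let $l$ denote a multi-index $(\lambda_1\in\Delta_1,\lambda_2\in\Delta_2,\ l=1,\dots,Z_{\lambda_1,\lambda_2})$; likewise $m$ is a multi-index containing $(\mu_1,\mu_2)$ and $n$ one containing $(\nu_1,\nu_2)$. Choose isometries $W_l\in A=N_1\otimes N_2^{\mathrm{opp}}$ with $W_l^*W_m=\delta_{lm}1$ and $\sum_lW_lW_l^*=1$, and put $$\theta=\sum_l W_l\,(\lambda_1\otimes\lambda_2^{\mathrm{opp}})(\cdot)\,W_l^*,$$ so that $d(\theta)=\sum_{\lambda_1,\lambda_2}Z_{\lambda_1,\lambda_2}d(\lambda_1)d(\lambda_2)$ and $W_l\in\mathrm{Hom}(\lambda_1\otimes\lambda_2^{\mathrm{opp}},\theta)$. Equip each $\mathrm{Hom}(\alpha^1_{\lambda_1},\alpha^2_{\lambda_2})$ with the scalar product $(\phi,\phi')=\Phi^1_{\lambda_1}(\phi^*\phi')$ and choose orthonormal bases $\{\phi_l:\ l=1,\dots,Z_{\lambda_1,\lambda_2}\}$. For $\lambda_i,\mu_i,\nu_i\in\Delta_i$ choose orthonormal isometric bases $T_{e_i}$ of $\mathrm{Hom}(\nu_i,\lambda_i\mu_i)$ (i.e. $T_e^*T_{e'}=\delta_{ee'}1$). Then $$w_1=\sum_{l,m,n}(W_l\times W_m)\circ\mathcal{T}_{lm}^n\circ W_n^*,\qquad \mathcal{T}_{lm}^n=\sum_{e_1,e_2}\zeta^n_{lm,e_1e_2}\;T_{e_1}\otimes(T_{e_2}^* )^{\mathrm{opp}},$$ where in $\mathcal{T}^n_{lm}$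 the sums run over the chosen bases of $\mathrm{Hom}(\nu_1,\lambda_1\mu_1)$ and $\mathrm{Hom}(\nu_2,\lambda_2\mu_2)$, and $$\zeta^n_{lm,e_1e_2}=\sqrt{\frac{d(\lambda_2)d(\mu_2)}{d(\theta)d(\nu_2)}}\;\Phi^1_{\nu_1}\!\left[\iota_1(T_{e_1}^* )(\phi_l^*\times\phi_m^* )\iota_2(T_{e_2})\phi_n\right].$$ Induced braiding operator: $$\varepsilon(\theta,\theta)=\sum_{l,m}(W_m\times W_l)\circ\left(\varepsilon_1(\lambda_1,\mu_1)\otimes(\varepsilon_2(\lambda_2,\mu_2)^* )^{\mathrm{opp}}\right)\circ(W_l\times W_m)^* .$$ *)

(* Defs.v *)
From HB Require Import structures.
From mathcomp Require Import all_boot all_order all_algebra.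
From mathcomp Require Import all_classical all_reals all_analysis.
From mathcomp Require Import complex.
Import Order.TTheory GRing.Theory Num.Theory.
Import numFieldNormedType.Exports.

Set Implicit Arguments.
Unset Strict Implicit.
Unset Printing Implicit Defensive.

Local Open Scope classical_set_scope.
Local Open Scope complex_scope.
Local Open Scope ring_scope.

HB.mixin Record CompleteNormedModule_isHilbert (R : realType) V
    of CompleteNormedModule R[i] V := {
  inner : {dot V for (@Num.conj R[i])} ;
  inner_norm : forall x : V, inner x x = `|x| ^+ 2 ;
  hilbert_nontrivial : exists x : V, x != 0
}.

(** Nonzero Hilbert spaces, so that B(H) is a nontrivial ring; the inner product
    is linear in its first argument. *)
#[short(type="hilbertType")]
HB.structure Definition Hilbert (R : realType) :=
  {V of CompleteNormedModule R[i] V & CompleteNormedModule_isHilbert R V}.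

(** B(H).  The Hilbert-space adjoint of a bounded operator exists and is unique
    (Riesz), so carrying it as a field neither adds nor removes operators. *)
Record bop (R : realType) (H : hilbertType R) := Bop {
  bop_fun :> H -> H ;
  bop_adj : H -> H ;
  bop_linear : linear bop_fun ;
  bop_adj_linear : linear bop_adj ;
  bop_continuous : continuous bop_fun ;
  bop_adj_continuous : continuous bop_adj ;
  bop_adjE : forall x y, inner (bop_fun x) y = inner x (bop_adj y)
}.

Section BopAlgebra.
Context (R : realType) (H : hilbertType R).
Local Notation C := R[i].
Implicit Types (S T : bop H) (z : C).

Lemma inner0l (y : H) : inner (0 : H) y = 0.
Proof. exact: linear0l. Qed.
Lemma inner0r (y : H) : inner y (0 : H) = 0.
Proof. exact: linear0r. Qed.
Lemma innerDl (x y z : H) : inner (x + y) z = inner x z + inner y z.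
Proof. exact: linearDl. Qed.
Lemma innerDr (x y z : H) : inner x (y + z) = inner x y + inner x z.
Proof. exact: linearDr. Qed.
Lemma innerNl (x y : H) : inner (- x) y = - inner x y.
Proof. exact: linearNl. Qed.
Lemma innerNr (x y : H) : inner x (- y) = - inner x y.
Proof. exact: linearNr. Qed.
Lemma innerZl z (x y : H) : inner (z *: x) y = z * inner x y.
Proof. exact: linearZl_LR. Qed.
Lemma innerZr z (x y : H) : inner x (z *: y) = z^* * inner x y.
Proof. exact: linearZr. Qed.
Lemma inner_conj (x y : H) : inner y x = (inner x y)^*.
Proof. by rewrite (@hermC _ _ _ _ inner y x) expr0 mul1r. Qed.

Lemma inner_inj (x y : H) : (forall w : H, inner w x = inner w y) -> x = y.
Proof.
move=> h; apply/eqP; rewrite -subr_eq0 -normr_eq0 -sqrf_eq0 -inner_norm.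
by rewrite innerDr innerNr h subrr.
Qed.

Lemma bopP S T : (forall x, S x = T x) -> S = T.
Proof.
case: S T => [f f' lf lf' cf cf' ff] [g g' lg lg' cg cg' gg] /= /funext fg.
move: lf cf ff; rewrite {}fg => lf cf ff.
have f'g' : f' = g'.
  by apply/funext => y; apply: inner_inj => w; rewrite -ff gg.
move: lf' cf' ff; rewrite f'g' => *.
by congr Bop; exact: Prop_irrelevance.
Qed.

HB.instance Definition _ := gen_eqMixin (bop H).
HB.instance Definition _ := gen_choiceMixin (bop H).

#[local] Obligation Tactic := idtac.

Program Definition bop0 : bop H := @Bop R H (fun=> 0) (fun=> 0) _ _ _ _ _.
Next Obligation. by move=> a u v; rewrite scaler0 addr0. Qed.
Next Obligation. by move=> a u v; rewrite scaler0 addr0. Qed.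
Next Obligation. exact: cst_continuous. Qed.
Next Obligation. exact: cst_continuous. Qed.
Next Obligation. by move=> * /=; rewrite inner0l inner0r. Qed.

Program Definition bop_add S T : bop H :=
  @Bop R H (fun x => S x + T x) (fun x => bop_adj S x + bop_adj T x) _ _ _ _ _.
Next Obligation.
by move=> S T a u v /=; rewrite !bop_linear scalerDr addrACA.
Qed.
Next Obligation.
by move=> S T a u v /=; rewrite !bop_adj_linear scalerDr addrACA.
Qed.
Next Obligation.
by move=> S T x; apply: continuousD; apply: bop_continuous.
Qed.
Next Obligation.
by move=> S T x; apply: continuousD; apply: bop_adj_continuous.
Qed.
Next Obligation. by move=> * /=; rewrite innerDl innerDr !bop_adjE. Qed.

Program Definition bop_scale z T : bop H :=
  @Bop R H (fun x => z *: T x) (fun x => z^* *: bop_adj T x) _ _ _ _ _.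
Next Obligation.
by move=> z T a u v /=; rewrite !bop_linear scalerDr !scalerA mulrC.
Qed.
Next Obligation.
by move=> z T a u v /=; rewrite !bop_adj_linear scalerDr !scalerA mulrC.
Qed.
Next Obligation.
by move=> z T x; apply: continuousZr; apply: bop_continuous.
Qed.
Next Obligation.
by move=> z T x; apply: continuousZr; apply: bop_adj_continuous.
Qed.
Next Obligation. by move=> * /=; rewrite innerZl innerZr conjCK bop_adjE. Qed.

Program Definition bop1 : bop H := @Bop R H id id _ _ _ _ _.
Next Obligation. by []. Qed.
Next Obligation. by []. Qed.
Next Obligation. by move=> x; apply: cvg_id. Qed.
Next Obligation. by move=> x; apply: cvg_id. Qed.
Next Obligation. by []. Qed.

Program Definition bop_mul S T : bop H :=
  @Bop R H (S \o T) (bop_adj T \o bop_adj S) _ _ _ _ _.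
Next Obligation. by move=> S T a u v /=; rewrite !bop_linear. Qed.
Next Obligation. by move=> S T a u v /=; rewrite !bop_adj_linear. Qed.
Next Obligation.
by move=> S T x; apply: continuous_comp; apply: bop_continuous.
Qed.
Next Obligation.
by move=> S T x; apply: continuous_comp; apply: bop_adj_continuous.
Qed.
Next Obligation. by move=> * /=; rewrite !bop_adjE. Qed.

Program Definition star T : bop H := @Bop R H (bop_adj T) T _ _ _ _ _.
Next Obligation. by move=> T; exact: bop_adj_linear. Qed.
Next Obligation. by move=> T; exact: bop_linear. Qed.
Next Obligation. by move=> T; exact: bop_adj_continuous. Qed.
Next Obligation. by move=> T; exact: bop_continuous. Qed.
Next Obligation. by move=> * /=; rewrite inner_conj -bop_adjE -inner_conj. Qed.

Definition bop_opp T := bop_scale (-1) T.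

Fact bop_addA : associative bop_add.
Proof. by move=> a b c; apply: bopP => x /=; rewrite addrA. Qed.
Fact bop_addC : commutative bop_add.
Proof. by move=> a b; apply: bopP => x /=; rewrite addrC. Qed.
Fact bop_add0 : left_id bop0 bop_add.
Proof. by move=> a; apply: bopP => x /=; rewrite add0r. Qed.
Fact bop_addN : left_inverse bop0 bop_opp bop_add.
Proof. by move=> a; apply: bopP => x /=; rewrite scaleN1r addNr. Qed.
HB.instance Definition _ :=
  GRing.isZmodule.Build (bop H) bop_addA bop_addC bop_add0 bop_addN.

Fact bop_mulA : associative bop_mul.
Proof. by move=> a b c; apply: bopP. Qed.
Fact bop_mul1l : left_id bop1 bop_mul.
Proof. by move=> a; apply: bopP. Qed.
Fact bop_mul1r : right_id bop1 bop_mul.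
Proof. by move=> a; apply: bopP. Qed.
Fact bop_mulDl : left_distributive bop_mul +%R.
Proof. by move=> a b c; apply: bopP. Qed.
Fact bop_mulDr : right_distributive bop_mul +%R.
Proof.
move=> a b c; apply: bopP => x /=.
by have := bop_linear a 1 (b x) (c x); rewrite !scale1r.
Qed.
Fact bop_oner_neq0 : bop1 != 0.
Proof.
apply/eqP => /(congr1 (fun T : bop H => (T : H -> H))) e.
by have [x /eqP] := hilbert_nontrivial (s := H); rewrite -[x]/(bop1 x) e.
Qed.
HB.instance Definition _ := GRing.Zmodule_isNzRing.Build (bop H)
  bop_mulA bop_mul1l bop_mul1r bop_mulDl bop_mulDr bop_oner_neq0.

Fact bop_scaleA z w T : bop_scale z (bop_scale w T) = bop_scale (z * w) T.
Proof. by apply: bopP => x /=; rewrite scalerA. Qed.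
Fact bop_scale1 : left_id 1 bop_scale.
Proof. by move=> a; apply: bopP => x /=; rewrite scale1r. Qed.
Fact bop_scaleDr : right_distributive bop_scale +%R.
Proof. by move=> z a b; apply: bopP => x /=; rewrite scalerDr. Qed.
Fact bop_scaleDl T : {morph bop_scale^~ T : a b / a + b}.
Proof. by move=> z w; apply: bopP => x /=; rewrite scalerDl. Qed.
HB.instance Definition _ := GRing.Zmodule_isLmodule.Build C (bop H)
  bop_scaleA bop_scale1 bop_scaleDr bop_scaleDl.

Fact bop_scaleAl z S T : z *: (S * T) = (z *: S) * T.
Proof. by apply: bopP. Qed.
HB.instance Definition _ := GRing.Lmodule_isLalgebra.Build C (bop H) bop_scaleAl.
Fact bop_scaleAr z S T : z *: (S * T) = S * (z *: T).
Proof. by apply: bopP => x /=; rewrite (scalable_linear (@bop_linear _ _ S)). Qed.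
HB.instance Definition _ := GRing.Lalgebra_isAlgebra.Build C (bop H) bop_scaleAr.

End BopAlgebra.

Section Norm.
Context (R : realType) (H : hilbertType R).

Definition opnorm (T : bop H) : R :=
  sup [set complex.Re `|T x| | x in [set x : H | `|x| <= 1]].

Definition ople (S T : bop H) := forall x : H, inner (S x) x <= inner (T x) x.

(** The [z] with [T = z%:A], and the junk value 0 if [T] is not scalar. *)
Definition scal (T : bop H) : R[i] := xget 0 [set z : R[i] | T = z%:A].

End Norm.

Section VonNeumann.
Context (R : realType) (H : hilbertType R).
Implicit Types N : set (bop H).

Definition commutant N : set (bop H) := [set T | forall S, N S -> T * S = S * T].

Definition von_neumann N :=
  (forall T, N T -> N (star T)) /\ commutant (commutant N) = N.

Definition factor N :=
  von_neumann N /\ N `&` commutant N = [set z%:A | z in [set: R[i]]].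

Definition projection (p : bop H) := star p = p /\ p * p = p.

(** For projections, [p * q = q] means q <= p. *)
Definition finite_projection N (p : bop H) :=
  forall v, N v -> star v * v = p -> p * (v * star v) = v * star v ->
  v * star v = p.

Definition type_III N :=
  forall p, N p -> projection p -> finite_projection N p -> p = 0.

Definition typeIII_factor N := factor N /\ type_III N.

End VonNeumann.

(** A morphism between von Neumann algebras N and M is represented by a map
    of the ambient operators, of which only the values on N matter. *)

Section Morphisms.
Context (R : realType) (H K : hilbertType R).
Variables (N : set (bop H)) (M : set (bop K)).
Implicit Types rho : bop H -> bop K.

Record unital_hom rho : Prop := UnitalHom {
  hom_mem : forall x, N x -> M (rho x) ;
  hom_lin : forall (z : R[i]) x y, N x -> N y ->
    rho (z *: x + y) = z *: rho x + rho y ;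
  hom_mul : forall x y, N x -> N y -> rho (x * y) = rho x * rho y ;
  hom_one : rho 1 = 1 ;
  hom_star : forall x, N x -> rho (star x) = star (rho x)
}.

Definition is_lub (L : Type) (le : L -> L -> Prop) (A D : set L) (s : L) :=
  [/\ A s, forall d, D d -> le d s &
      forall b, A b -> (forall d, D d -> le d b) -> le s b].

(** Normality: suprema of upward directed families of self-adjoint elements
    are preserved. *)
Definition normal_hom rho :=
  forall (D : set (bop H)) s,
    let selfadj_N := [set x | N x /\ star x = x] in
    let selfadj_M := [set x | M x /\ star x = x] in
    D !=set0 -> D `<=` selfadj_N ->
    (forall a b, D a -> D b -> exists c, [/\ D c, ople a c & ople b c]) ->
    is_lub (@ople R H) selfadj_N D s ->
    is_lub (@ople R K) selfadj_M (rho @` D) (rho s).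

Definition intertwiners rho sigma : set (bop K) :=
  [set T | M T /\ forall x, N x -> T * rho x = sigma x * T].

End Morphisms.

Section Dimension.
Context (R : realType) (H K : hilbertType R).
Variables (N : set (bop H)) (M : set (bop K)).

Definition conjugate_solution (rho : bop H -> bop K) (rhob : bop K -> bop H)
    (r : bop H) (rb : bop K) :=
  [/\ intertwiners N N id (rhob \o rho) r,
      intertwiners M M id (rho \o rhob) rb,
      rho (star r) * rb = 1 &
      rhob (star rb) * r = 1].

Definition conjugate (rho : bop H -> bop K) (rhob : bop K -> bop H) :=
  [/\ unital_hom N M rho, unital_hom M N rhob &
      exists r rb, conjugate_solution rho rhob r rb].

Definition finite_dim (rho : bop H -> bop K) := exists rhob, conjugate rho rhob.

(** Minimal (Longo-Roberts) dimension: the minimum of ||r|| ||rb|| over all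
    solutions of the conjugate equations. *)
Definition dimension (rho : bop H -> bop K) : R :=
  inf [set d | exists rhob r rb, [/\ unital_hom M N rhob,
    conjugate_solution rho rhob r rb & d = opnorm r * opnorm rb]].

End Dimension.

Section Endomorphisms.
Context (R : realType) (H : hilbertType R).
Variable N : set (bop H).
Implicit Types rho sigma : bop H -> bop H.

Definition End_fin rho := unital_hom N N rho /\ finite_dim N N rho.

Definition irreducible rho :=
  forall T, intertwiners N N rho rho T -> exists z : R[i], T = z%:A.

Definition unitary (u : bop H) := star u * u = 1 /\ u * star u = 1.

Definition equivalent rho sigma :=
  exists2 u, intertwiners N N rho sigma u & unitary u.

(** Direct sums exist only up to equivalence: rho is one when isometries of N
    realize the equivalence. *)
Definition is_direct_sum rho n (sigma : 'I_n -> bop H -> bop H) :=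
  exists W : 'I_n -> bop H,
    [/\ forall a, N (W a),
        forall a b, star (W a) * W b = (a == b)%:R,
        \sum_a W a * star (W a) = 1 &
        forall x, N x -> rho x = \sum_a W a * sigma a x * star (W a)].

(** Isometries normalized by d(rho)^-1, as opposed to [conjugate_solution]. *)
Definition conjugate_isometries rho rhob (r rb : bop H) :=
  [/\ intertwiners N N id (rhob \o rho) r /\ star r * r = 1,
      intertwiners N N id (rho \o rhob) rb /\ star rb * rb = 1,
      rho (star r) * rb = ((dimension N N rho)^-1)%:C%:A &
      rhob (star rb) * r = ((dimension N N rho)^-1)%:C%:A].

(** S x T = S rho(T), for S with source rho. *)
Definition mtens rho (S T : bop H) := S * rho T.

End Endomorphisms.

Section FiniteDim.
Context (R : realType) (H : hilbertType R).

Definition spans (S : set (bop H)) n (b : 'I_n -> bop H) :=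
  (forall a, S (b a)) /\
  forall T, S T -> exists c : 'I_n -> R[i], T = \sum_a c a *: b a.

Definition lin_free n (b : 'I_n -> bop H) :=
  forall c : 'I_n -> R[i], \sum_a c a *: b a = 0 -> forall a, c a = 0.

Definition vdim (S : set (bop H)) : nat :=
  xget 0%N [set n | exists2 b : 'I_n -> bop H, spans S b & lin_free b].

End FiniteDim.

Section Systems.
Context (R : realType) (H : hilbertType R).
Variables (N : set (bop H)) (D : finType) (lam : D -> bop H -> bop H).

Record closed_system : Prop := ClosedSystem {
  sys_fin : forall i, End_fin N (lam i) ;
  sys_irr : forall i, irreducible N (lam i) ;
  sys_ineq : forall i j, i != j -> ~ equivalent N (lam i) (lam j) ;
  sys_id : exists i, forall x, N x -> lam i x = x ;
  sys_conj : forall i, exists j, conjugate N N (lam i) (lam j) ;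
  sys_prod : forall i j, exists n (s : 'I_n -> D),
    is_direct_sum N (lam i \o lam j) (fun a => lam (s a))
}.

(** N is literally a subset of M, so the inclusion homomorphism iota is the
    identity map on operators. *)
Definition finite_index_subfactor (M : set (bop H)) :=
  [/\ typeIII_factor N, N `<=` M & finite_dim N M id].

Record extension (M : set (bop H)) (alpha : D -> bop H -> bop H) : Prop :=
  Extension {
  ext_fin : forall i, End_fin M (alpha i) ;
  ext_E1 : forall i x, N x -> lam i x = alpha i x ;
  ext_E2 : forall i j k, intertwiners N N (lam k) (lam i \o lam j)
    `<=` intertwiners M M (alpha k) (alpha i \o alpha j)
}.

(** The objects of Pi(Delta); only the values on N matter. *)
Definition products : set (bop H -> bop H) :=
  [set rho | exists s : seq D,
    forall x, N x -> rho x = foldr (fun i f => lam i \o f) id s x].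

(** Naturality forces [eps] to depend only on the restrictions of its arguments
    to N. *)
Record braiding (eps : (bop H -> bop H) -> (bop H -> bop H) -> bop H) : Prop :=
  Braiding {
  br_hom : forall rho sigma, products rho -> products sigma ->
    intertwiners N N (rho \o sigma) (sigma \o rho) (eps rho sigma) ;
  br_unitary : forall rho sigma, products rho -> products sigma ->
    unitary (eps rho sigma) ;
  br_natural : forall rho rho' sigma sigma' S T,
    products rho -> products rho' -> products sigma -> products sigma' ->
    intertwiners N N rho rho' S -> intertwiners N N sigma sigma' T ->
    eps rho' sigma' * mtens rho S T = mtens sigma T S * eps rho sigma ;
  br_hexagonl : forall rho sigma tau,
    products rho -> products sigma -> products tau ->
    eps (rho \o sigma) tau =
      mtens (rho \o tau) (eps rho tau) 1 * mtens rho 1 (eps sigma tau) ;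
  br_hexagonr : forall rho sigma tau,
    products rho -> products sigma -> products tau ->
    eps rho (sigma \o tau) =
      mtens sigma 1 (eps rho tau) * mtens (rho \o sigma) (eps rho sigma) 1
}.

Definition fusion_mult i j k :=
  vdim (intertwiners N N (lam k) (lam i \o lam j)).

Definition isometric_bases
    (T : forall i j k, 'I_(fusion_mult i j k) -> bop H) :=
  forall i j k, spans (intertwiners N N (lam k) (lam i \o lam j)) (T i j k) /\
    forall e e', star (T i j k e) * T i j k e' = (e == e')%:R.

Definition left_inverse (alpha : D -> bop H -> bop H) (bar : D -> D)
    (r : D -> bop H) (i : D) (X : bop H) : bop H :=
  star (r i) * alpha (bar i) X * r i.

End Systems.

Section Opposite.
Context (R : realType) (H H' : hilbertType R).

(** A realization of N^opp on a Hilbert space H', with x |-> x^opp. *)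
Record is_opposite (N : set (bop H)) (N' : set (bop H'))
    (opp : bop H -> bop H') : Prop := IsOpposite {
  opp_vN : von_neumann N' ;
  opp_bij : set_bij N N' opp ;
  opp_lin : forall (z : R[i]) x y, N x -> N y ->
    opp (z *: x + y) = z *: opp x + opp y ;
  opp_mul : forall x y, N x -> N y -> opp (x * y) = opp y * opp x ;
  opp_star : forall x, N x -> opp (star x) = star (opp x)
}.

Definition opp_end (N : set (bop H)) (opp : bop H -> bop H')
    (lam : bop H -> bop H) : bop H' -> bop H' :=
  opp \o lam \o 'pinv_(fun=> 0) N opp.

End Opposite.

Section Tensor.
Context (R : realType) (H1 H2 K : hilbertType R).

(** K, with x (x) y := t x y, is the Hilbert space tensor product of H1 and H2
    (unique up to unitary equivalence). *)
Record is_hilbert_tensor (t : {bilinear H1 -> H2 -> K}) : Prop :=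
  IsHilbertTensor {
  tensor_inner : forall x x' y y',
    inner (t x y) (t x' y') = inner x x' * inner y y' ;
  tensor_total : closure [set v | exists n (x : 'I_n -> H1) (y : 'I_n -> H2),
    v = \sum_a t (x a) (y a)] = setT
}.

(** This determines each [ot a b] uniquely, by totality of the [t x y]. *)
Definition is_operator_tensor (t : {bilinear H1 -> H2 -> K})
    (ot : bop H1 -> bop H2 -> bop K) :=
  forall a b x y, ot a b (t x y) = t (a x) (b y).

Definition vn_tensor (ot : bop H1 -> bop H2 -> bop K)
    (N1 : set (bop H1)) (N2 : set (bop H2)) : set (bop K) :=
  commutant (commutant [set ot a b | a in N1 & b in N2]).

(** F is rho (x) sigma: normality makes it unique, the elements a (x) b being
    only ultraweakly total in the von Neumann tensor product. *)
Record is_tensor_end ot (N1 : set (bop H1)) (N2 : set (bop H2))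
    (rho : bop H1 -> bop H1) (sigma : bop H2 -> bop H2)
    (F : bop K -> bop K) : Prop := IsTensorEnd {
  te_hom : unital_hom (vn_tensor ot N1 N2) (vn_tensor ot N1 N2) F ;
  te_normal : normal_hom (vn_tensor ot N1 N2) (vn_tensor ot N1 N2) F ;
  te_tensor : forall a b, N1 a -> N2 b -> F (ot a b) = ot (rho a) (sigma b)
}.

End Tensor.

Section Construction.
Context (R : realType) (H H' K : hilbertType R).
Variables (M N1 N2 : set (bop H)) (D1 D2 : finType).
Variables (lam1 alpha1 : D1 -> bop H -> bop H).
Variables (lam2 alpha2 : D2 -> bop H -> bop H).

Definition Zmult i j := vdim (intertwiners M M (alpha1 i) (alpha2 j)).

Definition multi_index := {ij : D1 * D2 & 'I_(Zmult ij.1 ij.2)}.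

Definition ix1 (l : multi_index) : D1 := (tag l).1.
Definition ix2 (l : multi_index) : D2 := (tag l).2.

Variables (bar : D1 -> D1) (r : D1 -> bop H).
Variable phi : forall i j, 'I_(Zmult i j) -> bop H.
Arguments phi : clear implicits.

Definition ix_phi (l : multi_index) : bop H := phi (ix1 l) (ix2 l) (tagged l).

Definition orthonormal_bases :=
  forall i j, spans (intertwiners M M (alpha1 i) (alpha2 j)) (phi i j) /\
    forall a b,
      scal (left_inverse alpha1 bar r i (star (phi i j a) * phi i j b)) =
      (a == b)%:R.

Variables (opp : bop H -> bop H') (ot : bop H -> bop H' -> bop K).
Variable F : D1 -> D2 -> bop K -> bop K.
Variable A : set (bop K).
Variable W : multi_index -> bop K.

Definition ix_end (l : multi_index) : bop K -> bop K := F (ix1 l) (ix2 l).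

Record isometries_W : Prop := IsometriesW {
  W_mem : forall l, A (W l) ;
  W_orth : forall l m, star (W l) * W m = (l == m)%:R ;
  W_total : \sum_l W l * star (W l) = 1
}.

Definition theta (x : bop K) : bop K :=
  \sum_l W l * ix_end l x * star (W l).

Variable T1 : forall i j k, 'I_(fusion_mult N1 lam1 i j k) -> bop H.
Variable T2 : forall i j k, 'I_(fusion_mult N2 lam2 i j k) -> bop H.
Arguments T1 : clear implicits.
Arguments T2 : clear implicits.

Definition zeta (l m n : multi_index)
    (e1 : 'I_(fusion_mult N1 lam1 (ix1 l) (ix1 m) (ix1 n)))
    (e2 : 'I_(fusion_mult N2 lam2 (ix2 l) (ix2 m) (ix2 n))) : R[i] :=
  let d l := dimension N2 N2 (lam2 (ix2 l)) in
  (Num.sqrt (d l * d m / (dimension A A theta * d n)))%:C *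
  scal (left_inverse alpha1 bar r (ix1 n)
    (star (T1 _ _ _ e1)
     * mtens (alpha2 (ix2 l)) (star (ix_phi l)) (star (ix_phi m))
     * T2 _ _ _ e2
     * ix_phi n)).

Definition calT (l m n : multi_index) : bop K :=
  \sum_e1 \sum_e2
    zeta e1 e2 *: ot (T1 (ix1 l) (ix1 m) (ix1 n) e1)
                     (opp (star (T2 (ix2 l) (ix2 m) (ix2 n) e2))).

Definition w1 : bop K :=
  \sum_l \sum_m \sum_n
    mtens (ix_end l) (W l) (W m) * calT l m n * star (W n).

Variables eps1 eps2 : (bop H -> bop H) -> (bop H -> bop H) -> bop H.

Definition eps_theta : bop K :=
  \sum_l \sum_m
    mtens (ix_end m) (W m) (W l)
    * ot (eps1 (lam1 (ix1 l)) (lam1 (ix1 m)))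
         (opp (star (eps2 (lam2 (ix2 l)) (lam2 (ix2 m)))))
    * star (mtens (ix_end l) (W l) (W m)).

End Construction.

(* Main.v *)
Require Import Defs.
From HB Require Import structures.
From mathcomp Require Import all_boot all_order all_algebra.
From mathcomp Require Import all_classical all_reals all_analysis.
From mathcomp Require Import complex.
Import Order.TTheory GRing.Theory Num.Theory.
Import numFieldNormedType.Exports.

Set Implicit Arguments.
Unset Strict Implicit.
Unset Printing Implicit Defensive.

Local Open Scope classical_set_scope.
Local Open Scope complex_scope.
Local Open Scope ring_scope.

(** Since the operators [W_l F_l(W_m)] are isometries with orthogonal ranges, the
    claim reduces to [eps(l, m) * T_lm^n = T_ml^n].  Expanding the image of the
    bases [T_e1], [T_e2] under the unitary braidings turns this into an identity
    between the coefficients [zeta], which is the adjoint of the hypothesis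
    relating [eps1] and [eps2], inserted into the left-inverse.  The expansion
    commutes with taking the scalar value of the left-inverse because the
    arguments lie in [Hom(alpha_nu, alpha_nu)], on which the left-inverse takes
    values in the center of the factor [M]; for this, [R_nu] has to intertwine
    [id_M] (and not just [id_N]), i.e. [alpha_id = id_M]. *)

(** * Adjoints and scalar values of operators *)

Section Star.
Context (R : realType) (H : hilbertType R).
Implicit Types (S T : bop H) (z : R[i]).

Lemma starK : involutive (@star R H).
Proof. by move=> T; apply: bopP. Qed.

Lemma starM S T : star (S * T) = star T * star S.
Proof. exact: bopP. Qed.

Lemma star1 : star (1 : bop H) = 1.
Proof. exact: bopP. Qed.

Lemma star0 : star (0 : bop H) = 0.
Proof. exact: bopP. Qed.

Lemma starD S T : star (S + T) = star S + star T.
Proof. exact: bopP. Qed.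

Lemma starZ z T : star (z *: T) = z^* *: star T.
Proof. exact: bopP. Qed.

Lemma star_sum (I : finType) (f : I -> bop H) :
  star (\sum_i f i) = \sum_i star (f i).
Proof. exact: (big_morph _ starD star0). Qed.

(** The squared norm of [T x] is the inner product of [x] with [star T * T] applied to [x]. *)
Lemma star_mul_eq0 T : star T * T = 0 -> T = 0.
Proof.
move=> TT; apply: bopP => x; apply/eqP.
rewrite -[T x == _]normr_eq0 -sqrf_eq0 -inner_norm bop_adjE.
by rewrite -[bop_adj T (T x)]/((star T * T) x) TT inner0r.
Qed.

Lemma scal_alg z : scal (z%:A : bop H) = z.
Proof.
rewrite /scal; case: xgetP => [w _ /= /eqP|/(_ z)]; last by case.
by rewrite -subr_eq0 -scalerBl scaler_eq0 oner_eq0 orbF subr_eq0 => /eqP.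
Qed.

(** Off the scalar operators [scal] takes the default value 0, so it is additive only on scalar
    terms, where it inverts the embedding of the scalars. *)
Lemma scal_sum (I : finType) (c : I -> R[i]) (X : I -> bop H) :
    (forall i, exists z, X i = z%:A) ->
  scal (\sum_i c i *: X i) = \sum_i c i * scal (X i).
Proof.
move=> hX; rewrite -[RHS]scal_alg scaler_suml; congr scal.
apply: eq_bigr => i _; have [z ->] := hX i.
by rewrite scal_alg scalerA.
Qed.

End Star.

(** * Von Neumann algebras as double commutants *)

Section VNAlgebra.
Context (R : realType) (H : hilbertType R).
Implicit Types (S T : bop H) (N : set (bop H)).

Lemma commutant1 N : commutant N 1.
Proof. by move=> S _; rewrite mul1r mulr1. Qed.

Lemma commutantM N S T : commutant N S -> commutant N T -> commutant N (S * T).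
Proof. by move=> hS hT U NU; rewrite -mulrA hT// mulrA hS// mulrA. Qed.

Lemma commutant_lin N (z : R[i]) S T :
  commutant N S -> commutant N T -> commutant N (z *: S + T).
Proof.
move=> hS hT U NU.
by rewrite mulrDl mulrDr hT// -scalerAl -scalerAr hS.
Qed.

Lemma commutant_star N T : (forall S, N S -> N (star S)) ->
  commutant N T -> commutant N (star T).
Proof.
move=> Nstar hT S NS; apply: (can_inj (@starK _ _)).
by rewrite !starM starK hT//; exact: Nstar.
Qed.

Section VN.
Context N (vN : von_neumann N).

Lemma vN_star T : N T -> N (star T).
Proof. exact: vN.1. Qed.

Lemma vN_1 : N 1.
Proof. by case: vN => _ <-; exact: commutant1. Qed.

Lemma vNM S T : N S -> N T -> N (S * T).
Proof. by case: vN => _ <-; exact: commutantM. Qed.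

Lemma vN_lin (z : R[i]) S T : N S -> N T -> N (z *: S + T).
Proof. by case: vN => _ <-; exact: commutant_lin. Qed.

Lemma vN0 : N 0.
Proof.
have := vN_lin (-1) vN_1 vN_1.
by rewrite scaleN1r addNr.
Qed.

End VN.

Lemma factor_center N T : Defs.factor N -> N T ->
  (forall S, N S -> T * S = S * T) -> exists z : R[i], T = z%:A.
Proof.
move=> [_ hN] NT cT.
have : (N `&` commutant N) T by [].
by rewrite hN => -[z _ <-]; exists z.
Qed.

End VNAlgebra.

(** * Intertwiners, and injectivity of endomorphisms of finite dimension *)

Section Hom.
Context (R : realType) (H K : hilbertType R).
Context (N : set (bop H)) (M : set (bop K)).
Context (vN : von_neumann N) (vM : von_neumann M).

Lemma hom0 rho : unital_hom N M rho -> rho 0 = 0.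
Proof.
move=> hr; have := hom_lin hr (-1) (vN_1 vN) (vN_1 vN).
by rewrite !scaleN1r !addNr.
Qed.

Lemma intertwiners_comp rho sigma tau S T :
  intertwiners N M sigma tau S -> intertwiners N M rho sigma T ->
  intertwiners N M rho tau (S * T).
Proof.
move=> [MS hS] [MT hT]; split; first exact: (vNM vM).
by move=> x Nx; rewrite -mulrA hT// mulrA hS// mulrA.
Qed.

Lemma intertwiners_star rho sigma T :
  (forall x, N x -> rho (star x) = star (rho x)) ->
  (forall x, N x -> sigma (star x) = star (sigma x)) ->
  intertwiners N M rho sigma T -> intertwiners N M sigma rho (star T).
Proof.
move=> hrho hsigma [MT hT]; split; first exact: (vN_star vM).
move=> x Nx; apply: (can_inj (@starK _ _)).
by rewrite !starM starK -hrho// -hsigma// hT//; exact: (vN_star vN).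
Qed.

End Hom.

Section Factor.
Context (R : realType) (H : hilbertType R) (M : set (bop H)).
Context (fM : Defs.factor M).

(** The operator [star r * r] is central, hence a scalar [z], and [r * x = rhob (rho x) * r]
    vanishes with [rho x]; so [z *: x = 0]. *)
Lemma End_fin_eq0 rho x : End_fin M rho -> M x -> rho x = 0 -> x = 0.
Proof.
have vM := fM.1.
move=> [hrho [rhob [_ hrhob [r [rb [[Mr hr] _ rrb _]]]]]] Mx rx.
have hr' y : M y -> star r * rhob (rho y) = y * star r.
  move=> My; apply: (can_inj (@starK _ _)); rewrite !starM starK.
  rewrite -(hom_star hrhob) -?(hom_star hrho)//; last exact: (hom_mem hrho).
  by rewrite -hr//; exact: (vN_star vM).
have [||z rz] := @factor_center _ _ _ (star r * r) fM.
- by apply: (vNM vM) => //; exact: (vN_star vM).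
- by move=> y My; rewrite -mulrA (hr y My)/= mulrA hr'// mulrA.
have rx0 : r * x = 0 by rewrite (hr x Mx)/= rx (hom0 vM hrhob) mul0r.
have : z *: x = 0.
  by rewrite -[x]mul1r scalerAl -rz -mulrA rx0 mulr0.
move/eqP; rewrite scaler_eq0 => /orP[/eqP z0|/eqP//].
(* If [z = 0] then [r = 0], which contradicts the conjugate equation [rho (star r) * rb = 1]. *)
have r0 : r = 0 by apply: star_mul_eq0; rewrite rz z0 scale0r.
move: rrb; rewrite r0 star0 (hom0 vM hrho) mul0r => /eqP.
by rewrite eq_sym oner_eq0.
Qed.

End Factor.

(** * Extensions of systems and their scalar left-inverses *)

Section Extension.
Context (R : realType) (H : hilbertType R) (M N : set (bop H)).
Context (D : finType) (lam alpha : D -> bop H -> bop H).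
Context (fM : Defs.factor M) (vN : von_neumann N).
Context (hlam : closed_system N lam) (halpha : extension N lam M alpha).

Let vM : von_neumann M := fM.1.

(* [1] intertwines [lam i] and [lam i \o lam i], so (E2) makes [alpha i]
   idempotent, and endomorphisms of finite dimension are injective. *)
Lemma extension_id i : (forall x, N x -> lam i x = x) ->
  forall x, M x -> alpha i x = x.
Proof.
move=> hi x Mx.
have [|_ ha] := @ext_E2 _ _ _ _ _ _ _ halpha i i i 1.
  by split=> [|y Ny]; [exact: vN_1|rewrite /= mul1r mulr1 !hi].
have hal := (ext_fin halpha i).1.
have Max : M (alpha i x) by exact: hom_mem hal _ _.
apply/eqP; rewrite -subr_eq0; apply/eqP.
apply: (End_fin_eq0 fM (ext_fin halpha i)).
  by rewrite addrC -scaleN1r; exact: vN_lin.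
rewrite addrC -scaleN1r (hom_lin hal)// scaleN1r.
by have /= := ha x Mx; rewrite mul1r mulr1 => <-; rewrite addNr.
Qed.

(** With [k] the index of the identity, [r] lies in [Hom(lam k, lam i lam j)], so (E2) applies, and
    [alpha k] is the identity on all of [M]. *)
Lemma extension_intertwiners_id i j r :
  intertwiners N N id (lam i \o lam j) r ->
  intertwiners M M id (alpha i \o alpha j) r.
Proof.
move=> [Nr hr]; have [k hk] := sys_id hlam.
have [|Mr ha] := @ext_E2 _ _ _ _ _ _ _ halpha i j k r.
  by split=> // x Nx; rewrite hk// hr.
split=> // x Mx.
by rewrite -ha// (extension_id hk).
Qed.

(** An element [y] of [M] passes through [r i] as [alpha (bar i) (alpha i y)], then through
    [alpha (bar i) X] because [X] commutes with [alpha i y], and leaves through [star (r i)] as [y].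
    The value is therefore central in [M]. *)
Lemma left_inverse_scalar (bar : D -> D) (r : D -> bop H) i X :
  intertwiners N N id (lam (bar i) \o lam i) (r i) ->
  intertwiners M M (alpha i) (alpha i) X ->
  exists z : R[i], Defs.left_inverse alpha bar r i X = z%:A.
Proof.
move=> /extension_intertwiners_id [Mr hr] [MX hX].
have hb := (ext_fin halpha (bar i)).1.
have ha := (ext_fin halpha i).1.
have hr' y : M y -> star (r i) * alpha (bar i) (alpha i y) = y * star (r i).
  move=> My; apply: (can_inj (@starK _ _)); rewrite !starM starK.
  rewrite -(hom_star hb) -?(hom_star ha)//; last exact: (hom_mem ha).
  by rewrite -hr//; exact: vN_star.
rewrite /Defs.left_inverse; apply: (factor_center fM).
  apply: vNM => //; apply: vNM => //; first exact: vN_star.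
  exact: (hom_mem hb).
move=> y My; rewrite -mulrA (hr y My)/= -!mulrA [in LHS](mulrA (alpha _ X)).
have May : M (alpha i y) by exact: (hom_mem ha).
by rewrite -(hom_mul hb)// hX// (hom_mul hb)// !mulrA hr'.
Qed.

End Extension.

(** * Linear combinations and isometric bases *)

Section Linear.
Context (C : pzRingType) (U V : lmodType C).

(** Morphisms and [opp] are linear only on their algebra, so linearity is assumed on a set [P]
    closed under linear combinations. *)
Lemma lin_on_sum (P : set U) (f : U -> V) (I : Type) (s : seq I) (c : I -> C)
    (X : I -> U) :
  P 0 -> (forall z x y, P x -> P y -> P (z *: x + y)) ->
  (forall z x y, P x -> P y -> f (z *: x + y) = z *: f x + f y) ->
  (forall i, P (X i)) ->
  f (\sum_(i <- s) c i *: X i) = \sum_(i <- s) c i *: f (X i).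
Proof.
move=> P0 Plin flin PX.
have Psum r : P (\sum_(i <- r) c i *: X i).
  elim: r => [|i r IH]; first by rewrite big_nil.
  by rewrite big_cons; apply: Plin.
elim: s => [|i s IH]; last by rewrite !big_cons flin ?IH.
(* Linearity with coefficient -1 and both arguments 0 gives [f 0 = 0]. *)
rewrite !big_nil; have := flin (-1) _ _ P0 P0.
by rewrite !scaleN1r !addNr.
Qed.

Lemma linear_sumZ (f : U -> V) (I : Type) (s : seq I) (c : I -> C) (X : I -> U) :
  linear f -> f (\sum_(i <- s) c i *: X i) = \sum_(i <- s) c i *: f (X i).
Proof. by move=> flin; apply: (lin_on_sum (P := setT)) => // *; exact: flin. Qed.

End Linear.

Section IsometricBases.
Context (R : realType) (H : hilbertType R).

(** Multiplying an expansion of [T] by [star (b e)] isolates the coefficient at [e]. *)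
Lemma isometric_basis_coord (S : set (bop H)) n (b : 'I_n -> bop H) T :
  spans S b -> (forall e e', star (b e) * b e' = (e == e')%:R) -> S T ->
  exists2 c : 'I_n -> R[i], T = \sum_e c e *: b e &
    forall e, star (b e) * T = (c e)%:A.
Proof.
move=> [_ sS] ob /sS[c ->]; exists c => // e.
rewrite mulr_sumr (bigD1 e)//= big1 ?addr0 => [|e' ne].
  by rewrite -scalerAr ob eqxx.
by rewrite -scalerAr ob eq_sym (negbTE ne) scaler0.
Qed.

(* The matrix of [u] in isometric bases has its conjugate transpose as the
   matrix of [star u]. *)
Lemma isometric_bases_matrix (S S' : set (bop H)) n n' (b : 'I_n -> bop H)
    (b' : 'I_n' -> bop H) (u : bop H) :
  spans S b -> (forall e e', star (b e) * b e' = (e == e')%:R) ->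
  spans S' b' -> (forall e e', star (b' e) * b' e' = (e == e')%:R) ->
  (forall T, S T -> S' (u * T)) -> (forall T, S' T -> S (star u * T)) ->
  exists c : 'I_n' -> 'I_n -> R[i],
    (forall e, u * b e = \sum_f c f e *: b' f) /\
    (forall f, star u * b' f = \sum_e (c f e)^* *: b e).
Proof.
move=> sS oS sS' oS' uS uS'.
have h e : exists c : 'I_n' -> R[i], u * b e = \sum_f c f *: b' f /\
    forall f, star (b' f) * (u * b e) = (c f)%:A.
  by have [c] := isometric_basis_coord sS' oS' (uS _ (sS.1 e)); exists c.
have [c hc] := choice h; exists (fun f e => c e f); split.
  by move=> e; exact: (hc e).1.
move=> f; have [d ud hd] := isometric_basis_coord sS oS (uS' _ (sS'.1 f)).
rewrite ud; apply: eq_bigr => e _; congr (_ *: _).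
have := congr1 (@star _ _) (hd e); rewrite !starM !starK -mulrA (hc e).2.
rewrite starZ star1 => /(congr1 (@scal _ _)).
by rewrite !scal_alg => ->; rewrite conjCK.
Qed.

End IsometricBases.

(** * Operators on a Hilbert space tensor product *)

Section OperatorTensor.
Context (R : realType) (H1 H2 K : hilbertType R).
Context (t : {bilinear H1 -> H2 -> K}) (ht : is_hilbert_tensor t).
Context (ot : bop H1 -> bop H2 -> bop K) (hot : is_operator_tensor t ot).

Lemma bop_sum (I : Type) (s : seq I) (S : bop K) (v : I -> K) :
  S (\sum_(i <- s) v i) = \sum_(i <- s) S (v i).
Proof.
under eq_bigr do rewrite -[v _]scale1r.
rewrite (linear_sumZ _ _ _ (@bop_linear _ _ S)).
by under eq_bigr do rewrite scale1r.
Qed.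

(** A [u] in [S] at distance less than [e] from [v] is orthogonal to [v], so [|v| <= |v - u| < e]
    for every positive [e]. *)
Lemma orth_dense (S : set K) (v : K) : closure S = setT ->
  (forall u, S u -> inner u v = 0) -> v = 0.
Proof.
move=> dS oS; apply/eqP; rewrite -normr_eq0; apply/eqP/le_anti.
rewrite normr_ge0 andbT; apply/ler_addgt0Pl => e e0; rewrite addr0.
have : closure S v by rewrite dS.
move=> /(_ _ (nbhsx_ballx v e e0))[u [Su]]; rewrite -ball_normE /= => vu.
apply: ltW; apply: le_lt_trans vu.
(* Pythagoras: [|v - u|^2 = |v|^2 + |u|^2] *)
rewrite -(@ler_pXn2r _ 2)// ?nnegrE// -!inner_norm.
have vu0 : inner v u = 0 by rewrite inner_conj oS// conjC0.
rewrite innerDl !innerDr !innerNl !innerNr vu0 (oS u Su) subr0 oppr0 add0r opprK.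
by rewrite lerDl inner_norm exprn_ge0.
Qed.

(** Since [S - T] kills the simple tensors, the range of its adjoint is orthogonal to their dense
    span, so the adjoint vanishes. *)
Lemma tensor_ext (S T : bop K) :
  (forall x y, S (t x y) = T (t x y)) -> S = T.
Proof.
move=> ST; apply/eqP; rewrite -subr_eq0; apply/eqP.
apply: (can_inj (@starK _ _)); rewrite star0; apply: bopP => w.
apply: orth_dense (tensor_total ht) _ => _ [n [x [y ->]]].
rewrite -[star _ w]/(bop_adj (S - T) w) -bop_adjE bop_sum big1 ?inner0l//.
by move=> k _; rewrite /= ST scaleN1r subrr.
Qed.

Lemma otM a a' b b' : ot a b * ot a' b' = ot (a * a') (b * b').
Proof. by apply: tensor_ext => x y; rewrite /= !hot. Qed.

Lemma ot_star a b : star (ot a b) = ot (star a) (star b).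
Proof.
apply: tensor_ext => x y; apply/eqP; rewrite -subr_eq0; apply/eqP.
(* It suffices to compare inner products with finite sums of simple tensors, where the adjoint can
   be moved in each factor separately. *)
apply: orth_dense (tensor_total ht) _ => _ [n [x' [y' ->]]].
rewrite innerDr innerNr; apply/eqP; rewrite subr_eq0; apply/eqP.
rewrite /= -bop_adjE bop_sum !hot.
have innerl_sum v (f : 'I_n -> K) :
    inner (\sum_k f k) v = \sum_k inner (f k) v.
  by rewrite (big_morph (inner^~ v) (fun u w => innerDl u w v) (inner0l v)).
rewrite !innerl_sum; apply: eq_bigr => k _.
by rewrite hot !(tensor_inner ht) !bop_adjE.
Qed.

Lemma ot_linl (z : R[i]) a a' b : ot (z *: a + a') b = z *: ot a b + ot a' b.
Proof.
apply: tensor_ext => x y; rewrite /= !hot /=.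
by rewrite linearPl.
Qed.

Lemma ot_linr (z : R[i]) a b b' : ot a (z *: b + b') = z *: ot a b + ot a b'.
Proof.
apply: tensor_ext => x y; rewrite /= !hot /=.
by rewrite linearPr.
Qed.

Lemma vn_tensor_vN N1 N2 : von_neumann N1 -> von_neumann N2 ->
  von_neumann (vn_tensor ot N1 N2).
Proof.
move=> vN1 vN2; split.
  move=> T; apply: commutant_star => S; apply: commutant_star.
  move=> _ [a Na [b Nb <-]]; rewrite ot_star.
  by exists (star a); [exact: vN_star|exists (star b) => //; exact: vN_star].
rewrite /vn_tensor; set G := [set ot a b | a in N1 & b in N2].
(* The inclusion of a set in its double commutant, applied to the commutant of [G], reduces four
   commutants to two. *)
suff cc (L : hilbertType R) (X : set (bop L)) : X `<=` commutant (commutant X).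
  apply/seteqP; split=> [T hT S hS|]; last exact: cc.
  by apply: hT; exact: cc.
by move=> S XS T /(_ _ XS).
Qed.

End OperatorTensor.

(** * Tensor products with the opposite algebra *)

Section OppositeTensor.
Context (R : realType) (H H' K : hilbertType R).
Context (N2 : set (bop H)) (N2op : set (bop H')) (opp : bop H -> bop H').
Context (vN2 : von_neumann N2) (hopp : is_opposite N2 N2op opp).
Context (t : {bilinear H -> H' -> K}) (ht : is_hilbert_tensor t).
Context (ot : bop H -> bop H' -> bop K) (hot : is_operator_tensor t ot).

(** Both [star] and [opp] reverse products, so their composite preserves them. *)
Lemma ot_opp_mul a a' b b' : N2 b -> N2 b' ->
  ot a (opp (star b)) * ot a' (opp (star b')) =
  ot (a * a') (opp (star (b * b'))).
Proof.
move=> Nb Nb'; rewrite (otM ht hot) -(opp_mul hopp) -?starM//.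
  exact: (vN_star vN2).
exact: (vN_star vN2).
Qed.

(** The composite of [opp] and [star] is antilinear, whence the conjugates on [d]. *)
Lemma ot_opp_sum (I J : finType) (c : I -> R[i]) (d : J -> R[i])
    (a : I -> bop H) (b : J -> bop H) : (forall j, N2 (b j)) ->
  ot (\sum_i c i *: a i) (opp (star (\sum_j d j *: b j))) =
  \sum_i \sum_j (c i * (d j)^*) *: ot (a i) (opp (star (b j))).
Proof.
move=> Nb; rewrite star_sum; under [in opp _]eq_bigr do rewrite starZ.
rewrite (lin_on_sum _ _ (vN0 vN2) (vN_lin vN2) (opp_lin hopp)); last first.
  by move=> j; exact: (vN_star vN2).
rewrite (@linear_sumZ _ _ _ (ot^~ _)); last first.
  by move=> z x y; rewrite (ot_linl ht hot).
apply: eq_bigr => i _; rewrite linear_sumZ; last first.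
  by move=> z x y; rewrite (ot_linr ht hot).
by rewrite scaler_sumr; apply: eq_bigr => j _; rewrite scalerA.
Qed.

End OppositeTensor.

(* Each term of the first factor meets exactly one pair [l, m] of the second. *)
Lemma orthonormal_sum_mul (R : realType) (K : hilbertType R) (I : finType)
    (P E : I -> I -> bop K) (T : I -> I -> I -> bop K) (V : I -> bop K) :
  (forall l m l' m', star (P l m) * P l' m' = ((l == l') && (m == m'))%:R) ->
  (forall l m n, E l m * T l m n = T m l n) ->
  (\sum_l \sum_m P m l * E l m * star (P l m)) *
  (\sum_l \sum_m \sum_n P l m * T l m n * V n) =
  \sum_l \sum_m \sum_n P l m * T l m n * V n.
Proof.
(* The term [(l, m)] of the first factor produces the term [(m, l)] of the right-hand side, so the
   two sums there are exchanged first. *)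
move=> oP ET; rewrite [RHS]exchange_big mulr_suml; apply: eq_bigr => l _.
rewrite mulr_suml; apply: eq_bigr => m _.
rewrite mulr_sumr (bigD1 l)//= [X in _ + X]big1 ?addr0; last first.
  move=> l' nl; rewrite mulr_sumr big1// => m' _.
  rewrite mulr_sumr big1// => n _.
  by rewrite !mulrA -(mulrA _ _ (P l' m')) oP eq_sym (negbTE nl) mulr0 !mul0r.
rewrite mulr_sumr (bigD1 m)//= [X in _ + X]big1 ?addr0; last first.
  move=> m' nm; rewrite mulr_sumr big1// => n _.
  rewrite !mulrA -(mulrA _ _ (P l m')) oP (eq_sym m) (negbTE nm) andbF.
  by rewrite mulr0 !mul0r.
rewrite mulr_sumr; apply: eq_bigr => n _.
by rewrite !mulrA -(mulrA _ _ (P l m)) oP !eqxx mulr1 -(mulrA _ _ (T _ _ _)) ET.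
Qed.

(** * Matrices of a braiding in bases of intertwiners *)

Section BraidingMatrix.
Context (R : realType) (H : hilbertType R) (N : set (bop H)).
Context (D : finType) (lam : D -> bop H -> bop H).
Context (eps : (bop H -> bop H) -> (bop H -> bop H) -> bop H).
Context (vN : von_neumann N) (hlam : closed_system N lam).
Context (heps : braiding N lam eps).

Lemma products1 i : products N lam (lam i).
Proof. by exists [:: i]. Qed.

Lemma eps_intertwiners i j :
  intertwiners N N (lam i \o lam j) (lam j \o lam i) (eps (lam i) (lam j)).
Proof. exact: (br_hom heps (products1 i) (products1 j)). Qed.

Lemma eps_unitary i j : Defs.unitary (eps (lam i) (lam j)).
Proof. exact: (br_unitary heps (products1 i) (products1 j)). Qed.

Lemma comp_star i j x : N x ->
  (lam i \o lam j) (star x) = star ((lam i \o lam j) x).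
Proof.
move=> Nx /=; have [[hi _] [hj _]] := (sys_fin hlam i, sys_fin hlam j).
by rewrite (hom_star hj)// (hom_star hi)//; exact: (hom_mem hj).
Qed.

(** Left multiplication by the braiding maps [Hom(lam k, lam i lam j)] to [Hom(lam k, lam j lam i)],
    and its adjoint maps back. The first expansion serves the operators [calT], the second the
    coefficients [zeta]. *)
Lemma eps_matrix (T : forall i j k, 'I_(fusion_mult N lam i j k) -> bop H)
    i j k :
  isometric_bases T ->
  exists c : 'I_(fusion_mult N lam j i k) ->
      'I_(fusion_mult N lam i j k) -> R[i],
    (forall e, eps (lam i) (lam j) * T i j k e = \sum_f c f e *: T j i k f) /\
    (forall f, star (eps (lam i) (lam j)) * T j i k f =
      \sum_e (c f e)^* *: T i j k e).
Proof.
move=> hT; apply: isometric_bases_matrix (hT i j k).1 (hT i j k).2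
  (hT j i k).1 (hT j i k).2 _ _ => S.
  exact: (intertwiners_comp vN) (eps_intertwiners i j).
apply: (intertwiners_comp vN).
apply: (intertwiners_star vN vN (comp_star i j) (comp_star j i)).
exact: eps_intertwiners.
Qed.

End BraidingMatrix.

(** * Exchanging the two indices in [zeta] and [calT] *)

Section InducedBraiding.
Context (R : realType) (H : hilbertType R) (M N1 N2 : set (bop H)).
Context (hM : typeIII_factor M).
Context (hN1 : finite_index_subfactor N1 M) (hN2 : finite_index_subfactor N2 M).
Context (D1 D2 : finType).
Context (lam1 : D1 -> bop H -> bop H) (lam2 : D2 -> bop H -> bop H).
Context (hlam1 : closed_system N1 lam1) (hlam2 : closed_system N2 lam2).
Context (alpha1 : D1 -> bop H -> bop H) (alpha2 : D2 -> bop H -> bop H).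
Context (halpha1 : extension N1 lam1 M alpha1).
Context (halpha2 : extension N2 lam2 M alpha2).
Context (eps1 eps2 : (bop H -> bop H) -> (bop H -> bop H) -> bop H).
Context (heps1 : braiding N1 lam1 eps1) (heps2 : braiding N2 lam2 eps2).
Context (hbraid : forall (i j : D1) (k l : D2) (phi psi : bop H),
    intertwiners M M (alpha1 i) (alpha2 k) phi ->
    intertwiners M M (alpha1 j) (alpha2 l) psi ->
    mtens (alpha1 j) psi phi * eps1 (lam1 i) (lam1 j) =
    eps2 (lam2 k) (lam2 l) * mtens (alpha1 i) phi psi).

Let fM : Defs.factor M := hM.1.
Let vM : von_neumann M := hM.1.1.
Let vN1 : von_neumann N1. Proof. by case: hN1 => -[[]]. Qed.
Let vN2 : von_neumann N2. Proof. by case: hN2 => -[[]]. Qed.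
Let hom1 i := (ext_fin halpha1 i).1.
Let hom2 i := (ext_fin halpha2 i).1.

(** This is the adjoint of [hbraid]. The intertwining relations first put both products into the
    form [sigma(T) S], whose adjoint is again a monoidal product, now with source in [alpha2];
    unitarity then moves [eps1] across. *)
Lemma star_mtens_braid i j k l f g :
  intertwiners M M (alpha1 i) (alpha2 k) f ->
  intertwiners M M (alpha1 j) (alpha2 l) g ->
  mtens (alpha2 l) (star g) (star f) =
  eps1 (lam1 i) (lam1 j) * mtens (alpha2 k) (star f) (star g)
    * star (eps2 (lam2 k) (lam2 l)).
Proof.
move=> hf hg; have := hbraid hf hg; rewrite /mtens hf.2 ?hg.2; last 2 first.
- exact: hf.1.
- exact: hg.1.
move=> /(congr1 (@star _ _)); rewrite !starM.
rewrite -!(hom_star (hom2 _)); [|exact: hg.1|exact: hf.1].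
move=> e; rewrite -mulrA -e.
by rewrite !mulrA (eps_unitary heps1 i j).2 mul1r.
Qed.

Context (bar : D1 -> D1) (r rb : D1 -> bop H).
Context (hr : forall i,
  conjugate_isometries N1 (lam1 i) (lam1 (bar i)) (r i) (rb i)).
Context (phi : forall i j, 'I_(Zmult M alpha1 alpha2 i j) -> bop H).
Context (hphi : orthonormal_bases bar r phi).
Context (T1 : forall i j k, 'I_(fusion_mult N1 lam1 i j k) -> bop H).
Context (hT1 : isometric_bases T1).
Context (T2 : forall i j k, 'I_(fusion_mult N2 lam2 i j k) -> bop H).
Context (hT2 : isometric_bases T2).

Local Notation multi_index := (multi_index M alpha1 alpha2).
Implicit Types l m n : multi_index.
Local Notation phi_ l := (ix_phi phi l).

Lemma ix_phi_intertwiners l :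
  intertwiners M M (alpha1 (ix1 l)) (alpha2 (ix2 l)) (phi_ l).
Proof. exact: (hphi _ _).1.1. Qed.

(** From right to left, the factors lead from [alpha1] at [n] to [alpha2] at [n], to the product of
    [alpha2] at [l] and [m], to that of [alpha1], and back; (E2) lets [T1] and [T2] intertwine over
    [M]. *)
Lemma zeta_arg_intertwiners l m n e1 e2 :
  intertwiners M M (alpha1 (ix1 n)) (alpha1 (ix1 n))
    (star (@T1 (ix1 l) (ix1 m) (ix1 n) e1)
     * mtens (alpha2 (ix2 l)) (star (phi_ l)) (star (phi_ m))
     * @T2 (ix2 l) (ix2 m) (ix2 n) e2 * phi_ n).
Proof.
have hS1 := @ext_E2 _ _ _ _ _ _ _ halpha1 _ _ _ _ ((hT1 _ _ _).1.1 e1).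
have hS2 := @ext_E2 _ _ _ _ _ _ _ halpha2 _ _ _ _ ((hT2 _ _ _).1.1 e2).
have st1 i := hom_star (hom1 i); have st2 i := hom_star (hom2 i).
have hp x : intertwiners M M (alpha2 (ix2 x)) (alpha1 (ix1 x)) (star (phi_ x)).
  exact: (intertwiners_star vM vM (st1 _) (st2 _) (ix_phi_intertwiners x)).
apply: (intertwiners_comp vM _ (ix_phi_intertwiners n)).
apply: (intertwiners_comp vM _ hS2).
apply: (@intertwiners_comp _ _ _ _ _ vM _ (alpha1 (ix1 l) \o alpha1 (ix1 m))).
  apply: (intertwiners_star vM vM (st1 _) _ hS1) => x Mx /=.
  rewrite (st1 (ix1 m) x Mx) (st1 (ix1 l))//.
  exact: (hom_mem (hom1 _)).
rewrite /mtens; split.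
  by apply: (vNM vM); [exact: (hp l).1|exact/(hom_mem (hom2 _))/(hp m).1].
move=> x Mx /=; have Mphi := (hp m).1.
rewrite -mulrA -(hom_mul (hom2 _))//; last exact: (hom_mem (hom2 _)).
rewrite (hp m).2// (hom_mul (hom2 _))//; last exact: (hom_mem (hom1 _)).
by rewrite mulrA (hp l).2 ?mulrA//; exact: (hom_mem (hom1 _)).
Qed.

Context (K : hilbertType R) (F : D1 -> D2 -> bop K -> bop K) (A : set (bop K)).
Context (W : multi_index -> bop K).

(** After [star_mtens_braid] the braidings are absorbed into [T1] and [T2]. As [T1] enters through
    its adjoint, [c1] appears without conjugation and [c2] with it. *)
Lemma zeta_braid l m n c1 c2 :
  (forall f, star (eps1 (lam1 (ix1 l)) (lam1 (ix1 m)))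
       * @T1 (ix1 m) (ix1 l) (ix1 n) f =
     \sum_e (c1 f e)^* *: @T1 (ix1 l) (ix1 m) (ix1 n) e) ->
  (forall f, star (eps2 (lam2 (ix2 l)) (lam2 (ix2 m)))
       * @T2 (ix2 m) (ix2 l) (ix2 n) f =
     \sum_e (c2 f e)^* *: @T2 (ix2 l) (ix2 m) (ix2 n) e) ->
  forall f1 f2,
  zeta bar r phi F A W T1 T2 (l := m) (m := l) (n := n) f1 f2 =
  \sum_e1 \sum_e2 (c1 f1 e1 * (c2 f2 e2)^*) *
    zeta bar r phi F A W T1 T2 (l := l) (m := m) (n := n) e1 e2.
Proof.
move=> h1 h2 f1 f2.
pose X p := star (@T1 (ix1 l) (ix1 m) (ix1 n) p.1)
  * mtens (alpha2 (ix2 l)) (star (phi_ l)) (star (phi_ m))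
  * @T2 (ix2 l) (ix2 m) (ix2 n) p.2 * phi_ n.
have MX p : M (X p) := (zeta_arg_intertwiners _ _).1.
rewrite /zeta (star_mtens_braid (ix_phi_intertwiners l) (ix_phi_intertwiners m)).
have -> : star (T1 f1)
    * (eps1 (lam1 (ix1 l)) (lam1 (ix1 m))
       * mtens (alpha2 (ix2 l)) (star (phi_ l)) (star (phi_ m))
       * star (eps2 (lam2 (ix2 l)) (lam2 (ix2 m)))) * T2 f2 * phi_ n =
    \sum_p (c1 f1 p.1 * (c2 f2 p.2)^*) *: X p.
  rewrite -(pair_bigA _ (fun e1 e2 => (c1 f1 e1 * (c2 f2 e2)^*) *: X (e1, e2)))/=.
  rewrite !mulrA -{1}[eps1 _ _]starK -starM h1 -(mulrA _ (star (eps2 _ _))) h2.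
  rewrite star_sum !mulr_suml; apply: eq_bigr => e1 _.
  rewrite mulr_sumr mulr_suml; apply: eq_bigr => e2 _.
  rewrite /X/mtens/= starZ conjCK !mulrA.
  by rewrite -!scalerAl -scalerAr -scalerAl scalerA mulrC.
rewrite (lin_on_sum (f := Defs.left_inverse alpha1 bar r (ix1 n)) _ _
  (vN0 vM) (vN_lin vM) _ MX); last first.
  move=> z x y Mx My; rewrite /Defs.left_inverse (hom_lin (hom1 _))//.
  by rewrite mulrDr mulrDl -scalerAr -scalerAl.
rewrite scal_sum => [|p]; last first.
  apply: (left_inverse_scalar fM vN1 hlam1 halpha1) (zeta_arg_intertwiners _ _).
  by case: (hr (ix1 n)) => -[].
rewrite pair_bigA mulr_sumr; apply: eq_bigr => p _ /=.
(* The square root in [zeta] is symmetric in [l] and [m]: only two dimension factors trade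
   places. *)
by rewrite [dimension N2 N2 _ * dimension N2 N2 _]mulrC mulrCA.
Qed.

Context (H' : hilbertType R) (N2op : set (bop H')) (opp : bop H -> bop H').
Context (hopp : is_opposite N2 N2op opp).
Context (t : {bilinear H -> H' -> K}) (ht : is_hilbert_tensor t).
Context (ot : bop H -> bop H' -> bop K) (hot : is_operator_tensor t ot).

(** Expanding both braided bases gives each new basis operator a coefficient that sums [zeta]
    against [c1] and the conjugate of [c2], the conjugate coming from antilinearity in the opposite
    factor. This is exactly the sum in [zeta_braid]. *)
Lemma calT_braid l m n :
  ot (eps1 (lam1 (ix1 l)) (lam1 (ix1 m)))
     (opp (star (eps2 (lam2 (ix2 l)) (lam2 (ix2 m)))))
  * calT bar r phi opp ot F A W T1 T2 l m n =
  calT bar r phi opp ot F A W T1 T2 m l n.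
Proof.
have [c1 [h1 h1']] := eps_matrix vN1 hlam1 heps1 (ix1 l) (ix1 m) (ix1 n) hT1.
have [c2 [h2 h2']] := eps_matrix vN2 hlam2 heps2 (ix2 l) (ix2 m) (ix2 n) hT2.
have NT2 i j k e : N2 (@T2 i j k e) by exact: ((hT2 i j k).1.1 e).1.
have Neps2 i j : N2 (eps2 (lam2 i) (lam2 j)).
  by exact: (eps_intertwiners heps2 i j).1.
rewrite /calT pair_bigA mulr_sumr.
under eq_bigr => p _.
  rewrite -scalerAr (ot_opp_mul vN2 hopp ht hot)// h1 h2.
  rewrite (ot_opp_sum vN2 hopp ht hot)// pair_bigA scaler_sumr.
  over.
rewrite exchange_big [RHS]pair_bigA; apply: eq_bigr => q _ /=.
rewrite (zeta_braid h1' h2') pair_bigA scaler_suml; apply: eq_bigr => p _.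
by rewrite scalerA mulrC.
Qed.

End InducedBraiding.

Theorem proposition1 (R : realType)
  (* the factor M, the subfactors N1, N2 *)
  (H : hilbertType R) (M N1 N2 : set (bop H))
  (hM : typeIII_factor M)
  (hN1 : finite_index_subfactor N1 M) (hN2 : finite_index_subfactor N2 M)
  (* the closed systems, their extensions and braidings *)
  (D1 D2 : finType)
  (lam1 : D1 -> bop H -> bop H) (lam2 : D2 -> bop H -> bop H)
  (hlam1 : closed_system N1 lam1) (hlam2 : closed_system N2 lam2)
  (alpha1 : D1 -> bop H -> bop H) (alpha2 : D2 -> bop H -> bop H)
  (halpha1 : extension N1 lam1 M alpha1) (halpha2 : extension N2 lam2 M alpha2)
  (eps1 eps2 : (bop H -> bop H) -> (bop H -> bop H) -> bop H)
  (heps1 : braiding N1 lam1 eps1) (heps2 : braiding N2 lam2 eps2)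
  (hbraid : forall (i j : D1) (k l : D2) (phi psi : bop H),
    intertwiners M M (alpha1 i) (alpha2 k) phi -> intertwiners M M (alpha1 j) (alpha2 l) psi ->
    mtens (alpha1 j) psi phi * eps1 (lam1 i) (lam1 j) =
    eps2 (lam2 k) (lam2 l) * mtens (alpha1 i) phi psi)
  (* the algebra A = N1 (x) N2^opp *)
  (H' K : hilbertType R)
  (N2op : set (bop H')) (opp : bop H -> bop H')
  (hopp : is_opposite N2 N2op opp)
  (t : {bilinear H -> H' -> K}) (ht : is_hilbert_tensor t)
  (ot : bop H -> bop H' -> bop K) (hot : is_operator_tensor t ot)
  (A : set (bop K)) (hA : A = vn_tensor ot N1 N2op)
  (* the endomorphisms lambda_1 (x) lambda_2^opp of A *)
  (F : D1 -> D2 -> bop K -> bop K)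
  (hF : forall i j,
    is_tensor_end ot N1 N2op (lam1 i) (opp_end N2 opp (lam2 j)) (F i j))
  (* the choices entering the construction of theta and w_1 *)
  (bar : D1 -> D1) (r rb : D1 -> bop H)
  (hr : forall i, conjugate_isometries N1 (lam1 i) (lam1 (bar i)) (r i) (rb i))
  (phi : forall i j, 'I_(Zmult M alpha1 alpha2 i j) -> bop H)
  (hphi : orthonormal_bases bar r phi)
  (T1 : forall i j k, 'I_(fusion_mult N1 lam1 i j k) -> bop H)
  (hT1 : isometric_bases T1)
  (T2 : forall i j k, 'I_(fusion_mult N2 lam2 i j k) -> bop H)
  (hT2 : isometric_bases T2)
  (W : multi_index M alpha1 alpha2 -> bop K)
  (hW : isometries_W A W) :
  eps_theta lam1 lam2 opp ot F W eps1 eps2 * w1 bar r phi opp ot F A W T1 T2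
  = w1 bar r phi opp ot F A W T1 T2.
Proof.
have vN1 : von_neumann N1 by case: hN1 => -[[]].
have vN2 : von_neumann N2 by case: hN2 => -[[]].
have vA : von_neumann A.
  by rewrite hA; exact: (vn_tensor_vN ht hot vN1 (opp_vN hopp)).
have hFA i j : unital_hom A A (F i j) by rewrite hA; exact: te_hom (hF i j).
(* Here [P l m] is [W l * F_l(W m)] and [E l m] is the tensor product of the two braidings. *)
apply: orthonormal_sum_mul => [l m l' m'|l m n]; last first.
  exact: (calT_braid hM hN1 hN2 hlam1 hlam2 halpha1 halpha2 heps1 heps2 hbraid
    hr hphi hT1 hT2 F A W hopp ht hot l m n).
rewrite /mtens starM mulrA -(mulrA _ (star (W l))) (W_orth hW).
case: (eqVneq l l') => [<-|_] /=; last by rewrite mulr0 mul0r.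
have AW := W_mem hW; have hl := hFA (ix1 l) (ix2 l).
(* For equal first indices the product is [F_l(star (W m) * W m')], and [F_l] preserves 1 and 0. *)
rewrite mulr1 -(hom_star hl)// -(hom_mul hl)//; last exact: (vN_star vA).
rewrite (W_orth hW); case: (m == m'); first exact: (hom_one hl).
exact: (hom0 vA hl).
Qed.
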